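(* Let $f\in\mathbb{R}[x,y]$ be a square-free polynomial defining a curve that is neither a union of parallel lines nor a union of concentric circles, and assume that for some $\ell$ the polynomial $\triangle^{\ell}f$ has degree $2$ and defines a circle centered at the origin. Let $k\le\ell$ be the smallest natural number such that $p=\triangle^kf$ defines a union of concentric circles centered at the origin, i.e. such that $p$ is a nonconstant polynomial in $r^2=x^2+y^2$, and let $\widehat f=\triangle^{k-1}f$. Let $\tilde p$ be the polynomial in $r^2=x^2+y^2$ such that $\triangle\tilde p=p$ and, viewed as a function of $r$, $\tilde p(0)=\tilde p'(0)=0$. Let $h=\widehat f-\tilde p$. Then $\mathbf{Symm}(f)\subset\mathbf{Symm}(h)$.
   Context: $\triangle f=\partial_x^2 f+\partial_y^2 f$ is the Laplacian, and $\triangle^j$ denotes its $j$-fold iterate. That $\triangle^\ell f$ defines a circle centered at the origin means that it has the form $a(x^2+y^2-\rho)$ with $a\neq0$; that $p$ defines a union of concentric circles centered at the origin means that $p$ is a nonzero constant times a product $\prod_i(x^2+y^2-\rho_i)$. Since the curve $f=0$ is not a union of concentric circles, $k\ge1$, so $\widehat f$ is well defined. For a polynomial $f\in\mathbb{R}[x,y]$, $\mathbf{Symm}(f)$ is the set of isometries $\phi$ of the plane (maps $X\mapsto AX+b$ with $A$ a real orthogonal $2\times2$ matrix, $b\in\mathbb{R}^2$) such that $f\circ\phi=\lambda f$ for some constant $\lambda\ne0$. Curves are considered as zero sets in $\mathbb{C}^2$. *)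

(* Defs.v *)
From mathcomp Require Export all_boot all_order all_algebra.
From mathcomp Require Export complex mpoly.
From mathcomp Require Export reals.

Set Implicit Arguments.
Unset Strict Implicit.
Unset Printing Implicit Defensive.

Export Order.TTheory GRing.Theory Num.Theory.

Open Scope ring_scope.

Section Defs.
Variable R : realType.

Definition laplacian (f : {mpoly R[2]}) : {mpoly R[2]} :=
  f^`M(0)^`M(0) + f^`M(1)^`M(1).

(* The units of {mpoly R[2]} are the nonzero constants; 0 is not
   square-free, since 0 = 'X_0 ^+ 2 * 0. *)
Definition squarefree (f : {mpoly R[2]}) : Prop :=
  forall g h : {mpoly R[2]}, f = g ^+ 2 * h -> g \is a GRing.unit.

Definition rsq (K : nzRingType) : {mpoly K[2]} := 'X_0 ^+ 2 + 'X_1 ^+ 2.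

(* q(x^2 + y^2); as a function of r this is q \Po 'X^2. *)
Definition in_rsq (q : {poly R}) : {mpoly R[2]} := horner_alg (rsq R) q.

Definition complexify (f : {mpoly R[2]}) : {mpoly R[i][2]} :=
  map_mpoly (real_complex R) f.

Definition in_curve (f : {mpoly R[2]}) (z : 'cV[R[i]]_2) : Prop :=
  (complexify f).@[fun i => z i 0] = 0.

(* Lines and circles are taken in C^2, so the offsets gam and the squared
   radii rho are complex: y^2 + 1 is a union of two parallel lines.  The
   common direction (resp. centre) is real: as f is real, its curve is
   invariant under complex conjugation, which forces this. *)
Definition is_union_parallel_lines (f : {mpoly R[2]}) : Prop :=
  exists (a : 'cV[R]_2) (s : seq R[i]), a != 0 /\
    forall z, in_curve f z <->
      exists2 gam, gam \in s & ((a 0 0)%:C * z 0 0 + (a 1 0)%:C * z 1 0)%C = gam.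

Definition is_union_concentric_circles (f : {mpoly R[2]}) : Prop :=
  exists (c : 'cV[R]_2) (s : seq R[i]),
    forall z, in_curve f z <->
      exists2 rho, rho \in s &
        ((z 0 0 - (c 0 0)%:C) ^+ 2 + (z 1 0 - (c 1 0)%:C) ^+ 2)%C = rho.

Definition defines_origin_circle (g : {mpoly R[2]}) : Prop :=
  exists a rho : R, a != 0 /\ g = a *: (rsq R - rho%:MP).

(* The rho_i are complex and the product is nonempty, so that these are
   exactly the nonconstant real polynomials in x^2 + y^2. *)
Definition defines_origin_circles (p : {mpoly R[2]}) : Prop :=
  exists (a : R[i]) (s : seq R[i]), [/\ a != 0, s != [::] &
    complexify p = a *: \prod_(rho <- s) (rsq R[i] - rho%:MP)].

Definition is_isometry (phi : 'cV[R]_2 -> 'cV[R]_2) : Prop :=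
  exists (A : 'M[R]_2) (b : 'cV[R]_2),
    A^T *m A = 1%:M /\ forall X, phi X = A *m X + b.

Definition plane_eval (f : {mpoly R[2]}) (X : 'cV[R]_2) : R :=
  f.@[fun i => X i 0].

Definition Symm (f : {mpoly R[2]}) (phi : 'cV[R]_2 -> 'cV[R]_2) : Prop :=
  is_isometry phi /\
  exists lam : R, lam != 0 /\
    forall X, plane_eval f (phi X) = lam * plane_eval f X.

End Defs.

(* Main.v *)
(** The Laplacian commutes with composition by isometries, so a symmetry phi of
    f, with f o phi = lam f, also satisfies (D^j f) o phi = lam (D^j f) for all
    j. For j = l this says that phi preserves a circle centered at the origin
    up to the factor lam, which forces phi to be linear and lam = 1. Hence phi
    fixes both D^(k-1) f and every polynomial in x^2 + y^2. *)

Require Import Defs.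
From mathcomp Require Import ring lra.

Set Implicit Arguments.
Unset Strict Implicit.
Unset Printing Implicit Defensive.

Section PolynomialIdentity.
Variable K : numFieldType.

(** [muni] regards [p] as a univariate polynomial in its last variable. As its coefficients
    determine [p], the vanishing of [p] can be proved by induction on the number of variables. *)
Lemma mcoeff_muni n (p : {mpoly K[n.+1]}) (m : 'X_{1..n.+1}) :
  (muni p)`_(m ord_max)@_[multinom m (widen_ord (leqnSn n) i) | i < n] = p@_m.
Proof.
rewrite muniE {3}(mpolyE p) coef_sum !raddf_sum /=; apply: eq_bigr => m' _.
rewrite coefZ coefXn mulr_natr mcoeffMn !mcoeffZ !mcoeffX -mulrnAr -mulrnA mulnb.
(* A monomial [m'] counts exactly when it agrees with [m] both at [ord_max] and at all other
   indices. *)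
congr (_ * _%:R); congr nat_of_bool; apply/andP/eqP => [[/eqP eq_m /eqP eq_max]|->].
  apply/mnmP => i; case: (unliftP ord_max i) => [j ->|-> //].
  have -> : lift ord_max j = widen_ord (leqnSn n) j.
    by apply: val_inj; rewrite /= /bump leqNgt ltn_ord.
  by have /mnmP/(_ j) := eq_m; rewrite !mnmE.
by rewrite !eqxx.
Qed.

Lemma horner_muni n (p : {mpoly K[n.+1]}) (v : 'I_n.+1 -> K) :
  (map_poly (meval (fun i => v (widen_ord (leqnSn n) i))) (muni p)).[v ord_max]
  = p.@[v].
Proof.
rewrite muniE [RHS]mevalE rmorph_sum horner_sum; apply: eq_bigr => m _.
rewrite /= map_polyZ map_polyXn hornerZ hornerXn /= mevalZ mevalX -mulrA.
rewrite big_ord_recr /=; congr (_ * (_ * _)).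
by apply: eq_bigr => i _; rewrite mnmE.
Qed.

(** In characteristic 0 the integers below [size p] are distinct; as roots they would outnumber the
    degree. *)
Lemma poly_horner_eq0 (p : {poly K}) : (forall t, p.[t] = 0) -> p = 0.
Proof.
move=> p0; apply/eqP; apply: contraT => nz_p.
have := @max_poly_roots _ p [seq i%:R | i <- iota 0 (size p)] nz_p.
rewrite size_map size_iota ltnn; apply.
  by apply/allP => t _; apply/rootP.
by rewrite map_inj_uniq ?iota_uniq // => i j /eqP; rewrite eqr_nat => /eqP.
Qed.

(** Fix values [w] of the first variables: [muni p], specialised at [w], is a univariate polynomial
    that vanishes everywhere, so its coefficients are 0. Hence each coefficient of [muni p] vanishes
    at every [w], and the induction hypothesis applies to it. *)
Lemma meval_eq0 n (p : {mpoly K[n]}) : (forall v, p.@[v] = 0) -> p = 0.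
Proof.
elim: n p => [|n IHn] p p0.
  by have := p0 (fun=> 0); rewrite (nvar0_mpolyC p) mevalC => ->.
apply/mpolyP => m; rewrite -mcoeff_muni mcoeff0.
suff -> : muni p = 0 by rewrite coef0 mcoeff0.
apply/polyP => k; rewrite coef0; apply: IHn => w.
rewrite -coef_map; set u := map_poly _ _; suff -> : u = 0 by rewrite coef0.
apply: poly_horner_eq0 => t.
(* The point [w] extended by [t] in the last coordinate. *)
pose v i := oapp w t (unlift ord_max i).
rewrite /u -[t](_ : v ord_max = t); last by rewrite /v unlift_none.
have -> : map_poly (meval w) (muni p) =
  map_poly (meval (fun i => v (widen_ord (leqnSn n) i))) (muni p).
  apply: eq_map_poly => g; apply: meval_eq => i.
  rewrite /v -[widen_ord _ i](_ : lift ord_max i = _) ?liftK //.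
  by apply: val_inj; rewrite /= /bump leqNgt ltn_ord.
by rewrite horner_muni.
Qed.

Lemma meval_inj n (p q : {mpoly K[n]}) : (forall v, p.@[v] = q.@[v]) -> p = q.
Proof.
by move=> eq_pq; apply/subr0_eq/meval_eq0 => v; rewrite mevalB eq_pq subrr.
Qed.

End PolynomialIdentity.

Lemma mderivXU n (K : nzRingType) (i j : 'I_n) :
  ('X_i : {mpoly K[n]})^`M(j) = (i == j)%:R.
Proof.
rewrite mderivX mnm1E; case: eqP => [->|_]; last by rewrite scale0r.
by rewrite -[X in (X - _)%MM]add0m addmK mpolyX0 scale1r.
Qed.

(** The chain rule. The identity [P] holds for constants and variables and is stable under products
    by the Leibniz rule, so it holds for monomials; both sides are linear in [p]. *)
Lemma mderiv_comp_mpoly n k (K : comNzRingType) (lq : k.-tuple {mpoly K[n]})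
    (p : {mpoly K[k]}) (j : 'I_n) :
  (p \mPo lq)^`M(j) = \sum_(i < k) (p^`M(i) \mPo lq) * (tnth lq i)^`M(j).
Proof.
pose P (g : {mpoly K[k]}) :=
  (g \mPo lq)^`M(j) = \sum_(i < k) (g^`M(i) \mPo lq) * (tnth lq i)^`M(j).
have PM g1 g2 : P g1 -> P g2 -> P (g1 * g2).
  rewrite /P => Pg1 Pg2; rewrite rmorphM mderivM Pg1 Pg2 mulr_suml mulr_sumr -big_split.
  apply: eq_bigr => i _ /=; rewrite mderivM rmorphD !rmorphM /=.
  ring.
have P1 : P 1.
  rewrite /P comp_mpoly1 -mpolyC1 mderivC big1 // => i _.
  by rewrite -mpolyC1 mderivC comp_mpoly0 mul0r.
have PX i : P 'X_i.
  rewrite /P comp_mpolyXU -tnth_nth (bigD1 i) //= big1 => [|i' ne_i'i].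
    by rewrite addr0 mderivXU eqxx comp_mpoly1 mul1r.
  by rewrite mderivXU eq_sym (negPf ne_i'i) comp_mpoly0 mul0r.
rewrite -/(P p); elim/mpolyind: p => [|c m p _ _ Pp].
  by rewrite /P comp_mpoly0 mderiv0 big1 // => i _; rewrite mderiv0 comp_mpoly0 mul0r.
have Pm : P 'X_[m].
  rewrite mpolyXE_id; apply: (big_ind P) => // i _.
  by elim: (m i) => [|e IHe]; rewrite ?expr0 // exprS; apply: PM.
rewrite /P comp_mpolyD comp_mpolyZ mderivD mderivZ Pp Pm scaler_sumr -big_split.
apply: eq_bigr => i _ /=.
by rewrite mderivD mderivZ comp_mpolyD comp_mpolyZ mulrDl scalerAl.
Qed.

Section Isometries.
Variable R : realType.
Implicit Types (A : 'M[R]_2) (b X : 'cV[R]_2) (f : {mpoly R[2]}).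

(** The coordinates of an affine map as polynomials, so that precomposition with the map becomes a
    substitution that can be differentiated formally. *)
Definition affine_tuple A b : 2.-tuple {mpoly R[2]} :=
  [tuple \sum_j A i j *: 'X_j + (b i 0)%:MP | i < 2].

Lemma plane_eval_affine A b f X :
  plane_eval (f \mPo affine_tuple A b) X = plane_eval f (A *m X + b).
Proof.
rewrite /plane_eval comp_mpoly_meval; apply: meval_eq => i.
rewrite tnth_mktuple mevalD mevalC !mxE raddf_sum /=; congr (_ + _).
by apply: eq_bigr => j _; rewrite mevalZ mevalXU.
Qed.

(** [Symm] compares functions on the plane, whereas [laplacian] is formal; this is the passage from
    the former to the latter. *)
Lemma plane_eval_inj f g : (forall X, plane_eval f X = plane_eval g X) -> f = g.
Proof.
move=> eq_fg; apply: meval_inj => v.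
have := eq_fg (\col_i v i); rewrite /plane_eval.
by rewrite !(@meval_eq _ _ _ v) // => i; rewrite mxE.
Qed.

Lemma mderiv_affine A b f j :
  (f \mPo affine_tuple A b)^`M(j) =
  \sum_i A i j *: (f^`M(i) \mPo affine_tuple A b).
Proof.
rewrite mderiv_comp_mpoly; apply: eq_bigr => i _.
rewrite tnth_mktuple mderivD mderivC addr0 [in LHS](raddf_sum (mderiv j)) /=.
rewrite (bigD1 j) //= [X in _ + X]big1 => [|j' /negPf ne_j'j].
  by rewrite addr0 mderivZ mderivXU eqxx -scalerAr mulr1.
by rewrite mderivZ mderivXU ne_j'j scaler0.
Qed.

Lemma laplacianE f : laplacian f = \sum_(i < 2) f^`M(i)^`M(i).
Proof.
rewrite big_ord_recl big_ord1 /laplacian.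
by rewrite (_ : lift ord0 ord0 = 1 :> 'I_2) //; apply: val_inj.
Qed.

(** By the chain rule applied twice, the second derivative of [f] in directions [i] and [i'] enters
    with coefficient [\sum_j A i j * A i' j], the [(i, i')] entry of [A *m A^T = 1%:M]. Only the
    diagonal terms survive. *)
Lemma laplacian_affine A b f : A^T *m A = 1%:M ->
  laplacian (f \mPo affine_tuple A b) = laplacian f \mPo affine_tuple A b.
Proof.
move=> /mulmx1C AAt; rewrite !laplacianE raddf_sum /=.
set T := affine_tuple A b.
have D j : (f \mPo T)^`M(j)^`M(j) =
    \sum_i \sum_i' (A i j * A i' j) *: (f^`M(i)^`M(i') \mPo T).
  rewrite mderiv_affine raddf_sum; apply: eq_bigr => i _ /=.
  rewrite mderivZ mderiv_affine scaler_sumr.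
  by apply: eq_bigr => i' _; rewrite scalerA.
under eq_bigr do rewrite D.
rewrite exchange_big; apply: eq_bigr => i _ /=.
rewrite exchange_big (bigD1 i) //= [X in _ + X]big1 => [|i' ne_i'i]; rewrite -scaler_suml.
  have := congr1 (fun M : 'M_2 => M i i) AAt; rewrite !mxE eqxx.
  by under eq_bigr do rewrite mxE; move=> ->; rewrite scale1r addr0.
have := congr1 (fun M : 'M_2 => M i i') AAt; rewrite !mxE eq_sym (negPf ne_i'i).
by under eq_bigr do rewrite mxE; move=> ->; rewrite scale0r.
Qed.

Lemma iter_laplacian_affine A b f j : A^T *m A = 1%:M ->
  iter j (@laplacian R) (f \mPo affine_tuple A b) =
  iter j (@laplacian R) f \mPo affine_tuple A b.
Proof. by move=> oA; elim: j => //= j ->; rewrite laplacian_affine. Qed.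

Lemma iter_laplacianZ c f j :
  iter j (@laplacian R) (c *: f) = c *: iter j (@laplacian R) f.
Proof. by elim: j => //= j ->; rewrite /laplacian !mderivZ scalerDr. Qed.

Definition norm2 X : R := X 0 0 ^+ 2 + X 1 0 ^+ 2.

Lemma norm2_orthogonal A X : A^T *m A = 1%:M -> norm2 (A *m X) = norm2 X.
Proof.
have norm2E Y : norm2 Y = (Y^T *m Y) 0 0.
  rewrite mxE big_ord_recl big_ord1 !mxE -!expr2.
  by rewrite (_ : lift ord0 ord0 = 1 :> 'I_2) //; apply: val_inj.
by move=> oA; rewrite !norm2E trmx_mul mulmxA -[_ *m A]mulmxA oA mulmx1.
Qed.

Lemma plane_eval_rsq X : plane_eval (rsq R) X = norm2 X.
Proof. by rewrite /plane_eval mevalD !rmorphXn /= !mevalXU. Qed.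

Lemma plane_eval_in_rsq (q : {poly R}) X : plane_eval (in_rsq q) X = q.[norm2 X].
Proof.
rewrite -plane_eval_rsq /plane_eval /in_rsq /horner_alg /=.
rewrite -horner_map -map_poly_comp map_poly_id // => c _ /=.
by rewrite mevalZ meval1 mulr1.
Qed.

(** Both sides are quadratic in [X]: the linear terms force the translation to vanish, the leading
    terms fix the factor. *)
Lemma circle_symm A b (rho lam : R) : A^T *m A = 1%:M ->
  (forall X, norm2 (A *m X + b) - rho = lam * (norm2 X - rho)) ->
  b = 0 /\ lam = 1.
Proof.
move=> oA symmA.
have symm_b y0 y1 : (y0 + b 0 0) ^+ 2 + (y1 + b 1 0) ^+ 2 - rho =
    lam * (y0 ^+ 2 + y1 ^+ 2 - rho).
  pose Y : 'cV[R]_2 := \col_i (if i == 0 then y0 else y1).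
  (* The substitution [X = A^T *m Y] removes [A] from the identity. *)
  have := symmA (A^T *m Y).
  rewrite mulmxA (mulmx1C oA) mul1mx (@norm2_orthogonal A^T) ?trmxK; last first.
    exact: mulmx1C.
  by rewrite /norm2 !mxE /=.
(* Opposite unit points have equal right-hand sides, and their left-hand sides differ by four times
   a coordinate of [b]. With [b = 0], comparing [(1, 0)] with the origin gives [lam = 1]. *)
have := symm_b 0 0; have := symm_b 1 0; have := symm_b (-1) 0.
have := symm_b 0 1; have := symm_b 0 (-1) => e1 e2 e3 e4 e5.
have b0 : b 0 0 = 0 by lra.
have b1 : b 1 0 = 0 by lra.
split; last by rewrite b0 b1 in e4 e5; lra.
apply/matrixP => i j; rewrite ord1 mxE.
case: i => [[|[|//]] lt_i2]; [rewrite -[RHS]b0 | rewrite -[RHS]b1];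
  by congr (b _ _); apply: val_inj.
Qed.

End Isometries.

Theorem proposition25 (R : realType) (f : {mpoly R[2]}) (l k : nat)
    (q : {poly R}) :
  let p := iter k (@laplacian R) f in
  let fhat := iter k.-1 (@laplacian R) f in
  let ptilde := in_rsq q in
  let h := fhat - ptilde in
  squarefree f ->
  ~ is_union_parallel_lines f ->
  ~ is_union_concentric_circles f ->
  msize (iter l (@laplacian R) f) = 3%N ->
  defines_origin_circle (iter l (@laplacian R) f) ->
  (k <= l)%N ->
  defines_origin_circles p ->
  (forall j, (j < k)%N -> ~ defines_origin_circles (iter j (@laplacian R) f)) ->
  laplacian ptilde = p ->
  (q \Po 'X^2).[0] = 0 ->
  (q \Po 'X^2)^`().[0] = 0 ->
  forall phi : 'cV[R]_2 -> 'cV[R]_2, Symm f phi -> Symm h phi.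
Proof.
move=> p fhat ptilde h _ _ _ _ [a [rho [nz_a lap_l]]] _ _ _ _ _ _ phi.
move=> [[A [b [oA phiE]]] [lam [nz_lam symm_f]]].
have fA : f \mPo affine_tuple A b = lam *: f.
  apply: plane_eval_inj => X.
  by rewrite plane_eval_affine -phiE symm_f /plane_eval mevalZ.
have symm_lap j X : plane_eval (iter j (@laplacian R) f) (phi X) =
    lam * plane_eval (iter j (@laplacian R) f) X.
  rewrite phiE -plane_eval_affine -iter_laplacian_affine // fA iter_laplacianZ.
  by rewrite /plane_eval mevalZ.
have [b0 lam1] : b = 0 /\ lam = 1.
  apply: (circle_symm (rho := rho) oA) => X; rewrite -phiE.
  (* The leading factor [a] of the circle is nonzero and cancels. *)
  have := symm_lap l X; rewrite lap_l /plane_eval !mevalZ !mevalB !mevalC.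
  rewrite -!/(plane_eval _ _) !plane_eval_rsq mulrCA.
  exact: mulfI.
split; first by exists A, b.
exists 1; split=> [|X]; first exact: oner_neq0.
have := symm_lap k.-1 X; rewrite lam1 !mul1r /h /plane_eval !mevalB => ->.
(* [ptilde] depends only on [norm2], which [phi], now linear and orthogonal, preserves. *)
congr (_ - _); rewrite -!/(plane_eval _ _) !plane_eval_in_rsq.
by rewrite phiE b0 addr0 norm2_orthogonal.
Qed.
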